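(* For any open cover $\mathcal{U}=\{U_a\}_{a\in A}$ of a topological space $X$, the natural map $\pi\colon|\check{C}(\mathcal{U})_*|\to X$ from the geometric realization of the Čech complex of $\mathcal{U}$ is a weak equivalence.
   Context: Spaces are arbitrary topological spaces; weak equivalence means weak homotopy equivalence. Open covers are indexed by a set $A$, repetitions allowed. For indices $a_0,\dots,a_n\in A$ put $U_{a_0\cdots a_n}=U_{a_0}\cap\cdots\cap U_{a_n}$. The Čech complex $\check{C}(\mathcal{U})_*$ is the simplicial space with $\check{C}(\mathcal{U})_n=\coprod_{(a_0,\dots,a_n)\in A^{n+1}}U_{a_0\cdots a_n}$, with face maps given by omitting indices (and inclusions) and degeneracies by repeating indices. $|\cdot|$ is the usual geometric realization of simplicial spaces, $|W_*|=\bigl[\coprod_nW_n\times\Delta^n\bigr]/\!\sim$, formed in the category of all topological spaces. The map $\pi$ is induced by the inclusions $U_{a_0\cdots a_n}\subseteq X$. *)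

(* Defs.v *)
From HB Require Import structures.
From Stdlib Require Import Relations.
From mathcomp Require Import all_boot all_order all_algebra generic_quotient.
From mathcomp Require Import ring lra.
From mathcomp Require Import all_classical all_reals all_analysis.
From mathcomp Require Import homotopy.

Set Implicit Arguments.
Unset Strict Implicit.
Unset Printing Implicit Defensive.

Import Order.TTheory GRing.Theory Num.Theory.
Import numFieldNormedType.Exports.

Local Open Scope classical_set_scope.
Local Open Scope ring_scope.
Local Open Scope quotient_scope.

Lemma comp_cts {X Y Z : topologicalType} (f : X -> Y) (g : Y -> Z) :
  continuous f -> continuous g -> continuous (fun x => g (f x)).
Proof. by move=> cf cg x; apply: continuous_comp; [exact: cf | exact: cg]. Qed.

Lemma pair_cts {X Y Z : topologicalType} (f : X -> Y) (g : X -> Z) :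
  continuous f -> continuous g -> continuous (fun x => (f x, g x)).
Proof. by move=> cf cg x; exact: (cvg_pair (cf x) (cg x)). Qed.

Lemma fst_cts {X Y : topologicalType} : continuous (@fst X Y).
Proof. by move=> x; exact: cvg_fst. Qed.

Lemma snd_cts {X Y : topologicalType} : continuous (@snd X Y).
Proof. by move=> x; exact: cvg_snd. Qed.

Lemma sigT_cts {I : choiceType} {X : I -> topologicalType} {Z : topologicalType}
    (f : {i : I & X i} -> Z) :
  (forall i, continuous (fun x : X i => f (existT _ i x))) -> continuous f.
Proof. by move=> cf [i x] V nV; exact: (cf i x V nV). Qed.

Definition unit_interval (R : realType) : Type := set_type (`[0 : R, 1]%classic).

HB.instance Definition _ (R : realType) :=
  Topological.copy (unit_interval R) (set_type (`[0 : R, 1]%classic)).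

Section UnitInterval.
Context {R : realType}.
Local Notation I := (unit_interval R).

Definition clamp (x : R) : R := Num.max 0 (Num.min 1 x).

Lemma clampP (x : R) : clamp x \in (`[0, 1]%classic : set R).
Proof.
rewrite mem_set //= in_itv /= /clamp le_max lexx /= ge_max ler01 /=.
by rewrite ge_min lexx.
Qed.

Definition to_interval (x : R) : I := exist _ (clamp x) (clampP x).

Lemma interval_val (s : I) : 0 <= val s <= 1.
Proof. by case: s => x /= /set_mem /=; rewrite in_itv. Qed.

Lemma to_intervalK (x : R) : 0 <= x <= 1 -> val (to_interval x) = x.
Proof.
by move=> /andP[x0 x1]; rewrite /= /clamp (min_idPr x1) (max_idPr x0).
Qed.

Lemma val_to_interval (s : I) : to_interval (val s) = s.
Proof. by apply: val_inj; rewrite to_intervalK // interval_val. Qed.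

Lemma to_interval_continuous : continuous to_interval.
Proof.
apply: continuous_comp_initial => x /=.
have -> : set_val \o to_interval = clamp by apply/funext => y; rewrite set_valE.
apply: continuous_max; first exact: cvg_cst.
by apply: continuous_min; [exact: cvg_cst | exact: cvg_id].
Qed.

Lemma interval_val_continuous : continuous (val : I -> R).
Proof.
have := @initial_continuous (unit_interval R) R set_val.
by rewrite set_valE.
Qed.

Lemma interval_zero_one_neq : to_interval 0 != to_interval 1.
Proof.
apply/eqP => /(congr1 val); rewrite !to_intervalK ?lexx ?ler01 //.
by move/eqP; rewrite eq_sym oner_eq0.
Qed.

HB.instance Definition _ := isBiPointed.Build I interval_zero_one_neq.

Lemma interval_val0 : val (zero : I) = 0.
Proof. by rewrite to_intervalK // lexx ler01. Qed.

Lemma interval_val1 : val (one : I) = 1.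
Proof. by rewrite to_intervalK // lexx ler01. Qed.

Section Concat.
Context {K Y : topologicalType}.
Implicit Types f g : K * I -> Y.

Definition hconcat f g : K * I -> Y := fun ks =>
  if val ks.2 <= 2^-1 then f (ks.1, to_interval (2 * val ks.2))
  else g (ks.1, to_interval (2 * val ks.2 - 1)).

Lemma hconcat_continuous f g : continuous f -> continuous g ->
  (forall k, f (k, one) = g (k, zero)) -> continuous (hconcat f g).
Proof.
move=> cf cg fg.
have cv : continuous (fun ks : K * I => val ks.2).
  exact: comp_cts snd_cts interval_val_continuous.
have c1 : continuous (fun ks : K * I => f (ks.1, to_interval (2 * val ks.2))).
  apply: comp_cts cf; apply: pair_cts; first exact: fst_cts.
  apply: comp_cts to_interval_continuous => ks.
  by apply: cvgM; [exact: cvg_cst | exact: cv].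
have c2 : continuous
    (fun ks : K * I => g (ks.1, to_interval (2 * val ks.2 - 1))).
  apply: comp_cts cg; apply: pair_cts; first exact: fst_cts.
  apply: comp_cts to_interval_continuous => ks.
  by apply: cvgB; [apply: cvgM; [exact: cvg_cst | exact: cv] | exact: cvg_cst].
pose A := [set ks : K * I | val ks.2 <= 2^-1].
pose B := [set ks : K * I | 2^-1 <= val ks.2].
have clA : closed A by apply: (preimage_closed _ (@closed_le R 2^-1)) => ks _; exact: cv.
have clB : closed B by apply: (preimage_closed _ (@closed_ge R 2^-1)) => ks _; exact: cv.
apply/continuous_subspace_setT.
have -> : [set: K * I] = A `|` B.
  apply/seteqP; split => // -[k s] _ /=.
  by case: (leP (val s) 2^-1) => [|/ltW] h; [left|right].
apply: withinU_continuous => //.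
- apply: (subspace_eq_continuous (f :=
    fun ks : K * I => f (ks.1, to_interval (2 * val ks.2)))).
    by move=> ks /set_mem kA; rewrite /hconcat /from_subspace ifT.
  exact: continuous_subspaceT.
- apply: (subspace_eq_continuous (f :=
    fun ks : K * I => g (ks.1, to_interval (2 * val ks.2 - 1)))).
    move=> [k s] /set_mem /= kB; rewrite /hconcat /from_subspace /=.
    case: ifPn => // sle.
    have -> : val s = 2^-1 by apply/le_anti; rewrite sle.
    by rewrite divff // subrr -fg.
  exact: continuous_subspaceT.
Qed.

Lemma hconcat0 f g k : hconcat f g (k, zero) = f (k, zero).
Proof. by rewrite /hconcat interval_val0 invr_ge0 ler0n mulr0. Qed.

Lemma hconcat1 f g k : hconcat f g (k, one) = g (k, one).
Proof.
rewrite /hconcat interval_val1 ifF; last by apply/negbTE; lra.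
by congr (g (_, _)); congr to_interval; ring.
Qed.

Definition hreverse f : K * I -> Y := fun ks =>
  f (ks.1, to_interval (1 - val ks.2)).

Lemma hreverse_continuous f : continuous f -> continuous (hreverse f).
Proof.
move=> cf; apply: comp_cts cf; apply: pair_cts; first exact: fst_cts.
apply: comp_cts to_interval_continuous => ks.
apply: cvgB; first exact: cvg_cst.
exact: (comp_cts snd_cts interval_val_continuous).
Qed.

Lemma hreverse0 f k : hreverse f (k, zero) = f (k, one).
Proof. by rewrite /hreverse interval_val0 subr0. Qed.

Lemma hreverse1 f k : hreverse f (k, one) = f (k, zero).
Proof. by rewrite /hreverse interval_val1 subrr. Qed.

End Concat.

End UnitInterval.

Section PathComponents.
Context (R : realType).
Local Notation I := (unit_interval R).

Section PathConnectedRel.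
Context {Y : topologicalType}.

Definition path_connected (x y : Y) : bool :=
  `[< squashed {path I from x to y} >].

Lemma path_connectedP (x y : Y) :
  reflect (exists2 p : I -> Y, continuous p & p zero = x /\ p one = y)
    (path_connected x y).
Proof.
apply: (iffP (asboolP _)) => [[p]|[p cp [p0 p1]]].
  by exists p; [exact: cts_fun | split; [exact: path_zero | exact: path_one]].
by split; exact: (mk_path cp p0 p1 : {path I from x to y}).
Qed.

Let at0_cts (h : I * I -> Y) : continuous h -> continuous (fun s => h (zero, s)).
Proof.
move=> ch; apply: comp_cts ch; apply: (@pair_cts I I I (cst zero) id).
  exact: cst_continuous.
by move=> s; exact: cvg_id.
Qed.

Lemma path_connected_refl : reflexive path_connected.
Proof.
by move=> x; apply/path_connectedP; exists (cst x); [exact: cst_continuous|].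
Qed.

Lemma path_connected_sym : symmetric path_connected.
Proof.
suff sub x y : path_connected x y -> path_connected y x.
  by move=> x y; apply/idP/idP; exact: sub.
move=> /path_connectedP[p cp [p0 p1]]; apply/path_connectedP.
exists (fun s => hreverse (p \o @snd I I) (zero, s)).
  by apply/at0_cts/hreverse_continuous/(comp_cts snd_cts).
by rewrite hreverse0 hreverse1 /= p0 p1.
Qed.

Lemma path_connected_trans : transitive path_connected.
Proof.
move=> y x z /path_connectedP[p cp [p0 p1]] /path_connectedP[q cq [q0 q1]].
apply/path_connectedP.
exists (fun s => hconcat (p \o @snd I I) (q \o @snd I I) (zero, s)).
  apply/at0_cts/hconcat_continuous; [exact: (comp_cts snd_cts) .. |].
  by move=> k /=; rewrite p1 q0.
by rewrite hconcat0 hconcat1 /= p0 q1.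
Qed.

Definition path_connected_equiv :=
  EquivRel _ path_connected_refl path_connected_sym path_connected_trans.

End PathConnectedRel.

Definition pi0 (Y : topologicalType) : choiceType :=
  {eq_quot @path_connected_equiv Y}.

Definition pi0_class {Y : topologicalType} (y : Y) : pi0 Y :=
  \pi_{eq_quot @path_connected_equiv Y} y.

Definition pi0_map {Y Z : topologicalType} (f : continuousType Y Z)
    (c : pi0 Y) : pi0 Z :=
  pi0_class (f (repr (c : {eq_quot @path_connected_equiv Y}))).

Lemma pi0_mapE {Y Z : topologicalType} (f : continuousType Y Z) (y : Y) :
  pi0_map f (pi0_class y) = pi0_class (f y).
Proof.
apply/eqmodP => /=.
have /eqmodP/path_connectedP[p cp [p0 p1]] :
    repr (\pi_{eq_quot @path_connected_equiv Y} y) =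
    y %[mod {eq_quot @path_connected_equiv Y}] by rewrite reprK.
apply/path_connectedP; exists (f \o p); last by rewrite /= p0 p1.
by move=> s; apply: continuous_comp; [exact: cp | exact: cts_fun].
Qed.

End PathComponents.

Section HomotopyGroups.
Context (R : realType).
Local Notation I := (unit_interval R).

Definition homotopic_rel {K Y : topologicalType} (B : set K) (f g : K -> Y) :=
  exists H : continuousType (K * I)%type Y,
    [/\ forall k, H (k, zero) = f k,
        forall k, H (k, one) = g k &
        forall k s, B k -> H (k, s) = f k].

Definition cube (n : nat) : topologicalType :=
  set_type [set t : 'rV[R]_n | forall i, 0 <= t 0 i <= 1].

Definition cube_boundary (n : nat) : set (cube n) :=
  [set t : cube n | exists i, val t 0 i = 0 \/ val t 0 i = 1].

Section Based.
Context {Y : topologicalType} (n : nat) (y : Y).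

Definition based_cube_map : choiceType :=
  set_type [set g : continuousType (cube n) Y |
              forall t, cube_boundary t -> g t = y].

Definition based_homotopic (g h : based_cube_map) : bool :=
  `[< homotopic_rel (@cube_boundary n) (val g) (val h) >].

Lemma based_homotopic_refl : reflexive based_homotopic.
Proof.
move=> g; apply/asboolP.
have cH : continuous (val g \o @fst (cube n) I).
  by move=> ks; apply: continuous_comp; [exact: cvg_fst | exact: cts_fun].
by exists (mkcts cH).
Qed.

Lemma based_homotopic_sym : symmetric based_homotopic.
Proof.
suff sub g h : based_homotopic g h -> based_homotopic h g.
  by move=> g h; apply/idP/idP; exact: sub.
move=> /asboolP[H [H0 H1 HB]]; apply/asboolP.
exists (mkcts (hreverse_continuous (@cts_fun _ _ H))).
split=> [k|k|k s kB] /=; first by rewrite /mkcts hreverse0.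
- by rewrite /mkcts hreverse1.
- by rewrite /mkcts /hreverse HB // -H1 HB.
Qed.

Lemma based_homotopic_trans : transitive based_homotopic.
Proof.
move=> h g l /asboolP[H [H0 H1 HB]] /asboolP[L [L0 L1 LB]]; apply/asboolP.
have HL k : H (k, one) = L (k, zero) by rewrite H1 L0.
exists (mkcts (hconcat_continuous (@cts_fun _ _ H) (@cts_fun _ _ L) HL)).
split=> [k|k|k s kB] /=.
- by rewrite /mkcts hconcat0.
- by rewrite /mkcts hconcat1.
- rewrite /mkcts /hconcat; case: ifP => _ /=; first by rewrite HB.
  by rewrite LB // -H1 HB.
Qed.

Definition based_homotopic_equiv :=
  EquivRel _ based_homotopic_refl based_homotopic_sym based_homotopic_trans.

(** The underlying set of the [n]-th homotopy group of [Y] at [y]. *)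
Definition homotopy_group : choiceType := {eq_quot based_homotopic_equiv}.

Definition homotopy_class (g : based_cube_map) : homotopy_group :=
  \pi_{eq_quot based_homotopic_equiv} g.

End Based.

Section Functoriality.
Context {Y Z : topologicalType} (f : continuousType Y Z) (n : nat) (y : Y).

Lemma based_cube_push_subproof (g : based_cube_map n y) :
  (f \o val g : continuousType (cube n) Z) \in
    [set g : continuousType (cube n) Z |
       forall t, cube_boundary t -> g t = f y].
Proof. by apply/mem_set => t tB /=; rewrite (set_mem (valP g)). Qed.

Definition based_cube_push (g : based_cube_map n y) : based_cube_map n (f y) :=
  exist _ (f \o val g : continuousType (cube n) Z)
    (based_cube_push_subproof g).

Definition homotopy_group_map (c : homotopy_group n y) :
    homotopy_group n (f y) :=
  homotopy_class (based_cube_push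
    (repr (c : {eq_quot @based_homotopic_equiv Y n y}))).

Lemma homotopy_group_mapE (g : based_cube_map n y) :
  homotopy_group_map (homotopy_class g) = homotopy_class (based_cube_push g).
Proof.
apply/eqmodP => /=.
have /eqmodP/asboolP[H [H0 H1 HB]] :
    repr (\pi_{eq_quot @based_homotopic_equiv Y n y} g) =
    g %[mod {eq_quot @based_homotopic_equiv Y n y}] by rewrite reprK.
apply/asboolP; exists (f \o H); split=> [k|k|k s kB] /=.
- by rewrite H0.
- by rewrite H1.
- by rewrite HB.
Qed.

End Functoriality.

(** Since induced maps in positive degrees are always group morphisms, they are
    isomorphisms exactly when they are bijective.  Path components are treated
    without base point so that the definition is correct for empty [Y]. *)
Record weak_equivalence {Y Z : topologicalType} (f : continuousType Y Z) :
    Prop := WeakEquivalence {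
  weak_equivalence_pi0 : bijective (@pi0_map R Y Z f);
  weak_equivalence_pin :
    forall (n : nat) (y : Y), bijective (@homotopy_group_map Y Z f n.+1 y)
}.

End HomotopyGroups.

(** A simplicial space is a contravariant functor from the category of the
    ordinals [0 < ... < n] and monotone maps; the face [d_i] and the degeneracy
    [s_i] are the actions of the monotone injection missing [i] and of the
    monotone surjection repeating [i]. *)
Record simplicialSpace := SimplicialSpace {
  simplices :> nat -> topologicalType;
  sact : forall m n : nat,
    {omorphism 'I_m.+1 -> 'I_n.+1} -> simplices n -> simplices m;
  sact_continuous : forall m n (theta : {omorphism 'I_m.+1 -> 'I_n.+1}),
    continuous (sact theta);
  sact_id : forall n (w : simplices n), sact idfun w = w;
  sact_comp : forall l m n (eta : {omorphism 'I_l.+1 -> 'I_m.+1})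
      (theta : {omorphism 'I_m.+1 -> 'I_n.+1}) (w : simplices n),
    sact (theta \o eta) w = sact eta (sact theta w)
}.

Section Realization.
Context (R : realType).

Definition simplex_set (n : nat) : set 'rV[R]_n.+1 :=
  [set t | (forall i, 0 <= t 0 i) /\ \sum_i t 0 i = 1].

Definition simplex (n : nat) : topologicalType := set_type (@simplex_set n).

Section Push.
Context {m n : nat} (theta : 'I_m.+1 -> 'I_n.+1).

Lemma simplex_push_subproof (t : simplex m) :
  \row_j (\sum_(i | theta i == j) val t 0 i) \in @simplex_set n.
Proof.
have [t0 t1] := set_mem (valP t); apply/mem_set; split=> [j|].
  by rewrite mxE; apply: sumr_ge0.
under eq_bigr do rewrite mxE.
by rewrite -t1 (partition_big theta predT).
Qed.

(** The affine map sending the vertex [i] to the vertex [theta i]. *)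
Definition simplex_push (t : simplex m) : simplex n :=
  exist _ (\row_j (\sum_(i | theta i == j) val t 0 i))
    (simplex_push_subproof t).

End Push.

Context (W : simplicialSpace).

Definition pre_realization : topologicalType :=
  {n : nat & (W n * simplex n)%type}.

Inductive realization_glue : pre_realization -> pre_realization -> Prop :=
  RealizationGlue m n (theta : {omorphism 'I_m.+1 -> 'I_n.+1})
      (w : W n) (t : simplex m) :
    realization_glue (existT _ m (sact theta w, t))
                     (existT _ n (w, simplex_push theta t)).

Definition realization_eq (p q : pre_realization) : bool :=
  `[< clos_refl_sym_trans _ realization_glue p q >].

Lemma realization_eq_refl : reflexive realization_eq.
Proof. by move=> p; apply/asboolP; exact: rst_refl. Qed.

Lemma realization_eq_sym : symmetric realization_eq.
Proof.
by move=> p q; apply/asboolP/asboolP => h; exact: rst_sym.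
Qed.

Lemma realization_eq_trans : transitive realization_eq.
Proof.
move=> q p r /asboolP pq /asboolP qr.
by apply/asboolP; exact: (rst_trans _ _ _ q).
Qed.

Definition realization_equiv :=
  EquivRel _ realization_eq_refl realization_eq_sym realization_eq_trans.

Definition realization : topologicalType :=
  quotient_topology {eq_quot realization_equiv}.

Definition realization_class (p : pre_realization) : realization :=
  \pi_{eq_quot realization_equiv} p.

End Realization.

Section Cech.
Context {X : topologicalType} {A : choiceType} (U : A -> set X).

Definition cech_inter (n : nat) (a : 'I_n.+1 -> A) : set X :=
  \bigcap_(i : 'I_n.+1) U (a i).

Definition cech_simplices (n : nat) : topologicalType :=
  {a : 'I_n.+1 -> A & set_type (cech_inter a)}.

Section Act.
Context {m n : nat} (theta : 'I_m.+1 -> 'I_n.+1).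

Lemma cech_act_subproof (a : 'I_n.+1 -> A) (x : set_type (cech_inter a)) :
  val x \in cech_inter (a \o theta).
Proof. by apply/mem_set => i _; exact: (set_mem (valP x)). Qed.

Definition cech_incl (a : 'I_n.+1 -> A) (x : set_type (cech_inter a)) :
    set_type (cech_inter (a \o theta)) :=
  exist _ (val x) (cech_act_subproof x).

Definition cech_act (w : cech_simplices n) : cech_simplices m :=
  existT _ (projT1 w \o theta) (cech_incl (projT2 w)).

Lemma cech_act_continuous : continuous cech_act.
Proof.
apply: sigT_cts => a /=.
apply: (@comp_cts _ _ _ (@cech_incl a)
  (existT (fun b => set_type (cech_inter b)) (a \o theta))).
  move=> x; apply: (@continuous_comp_initial _ _ _
    (set_val : set_type (cech_inter (a \o theta)) -> X)).
  have -> : set_val \o @cech_incl a = set_val.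
    by apply/funext => z; rewrite /= !set_valE.
  exact: initial_continuous.
exact: (@existT_continuous _
  (fun b : 'I_m.+1 -> A => set_type (cech_inter b) : topologicalType)
  (a \o theta)).
Qed.

End Act.

Lemma cech_act_id n (w : cech_simplices n) : cech_act idfun w = w.
Proof.
case: w => a x; rewrite /cech_act /=; congr (existT _ _ _); exact: val_inj.
Qed.

Lemma cech_act_comp l m n (eta : 'I_l.+1 -> 'I_m.+1)
    (theta : 'I_m.+1 -> 'I_n.+1) (w : cech_simplices n) :
  cech_act (theta \o eta) w = cech_act eta (cech_act theta w).
Proof. by congr (existT _ _ _); exact: val_inj. Qed.

Definition cech_complex : simplicialSpace :=
  @SimplicialSpace cech_simplices (fun m n theta => @cech_act m n theta)
    (fun m n theta => @cech_act_continuous m n theta)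
    cech_act_id
    (fun l m n eta theta => @cech_act_comp l m n eta theta).

Context (R : realType).

Definition cech_pre_projection (p : pre_realization R cech_complex) : X :=
  val (projT2 (projT2 p).1).

(** Well defined on classes by [cech_projectionE]. *)
Definition cech_projection (q : realization R cech_complex) : X :=
  cech_pre_projection
    (repr (q : {eq_quot realization_equiv R cech_complex})).

Lemma cech_pre_projection_eq (p q : pre_realization R cech_complex) :
  realization_eq p q -> cech_pre_projection p = cech_pre_projection q.
Proof.
move=> /asboolP; elim=> {p q} [_ _ [m n theta w t]|//|p q _ -> //|].
  by [].
by move=> p q r _ -> _ ->.
Qed.

Lemma cech_projectionE (p : pre_realization R cech_complex) :
  cech_projection (realization_class p) = cech_pre_projection p.
Proof.
apply: cech_pre_projection_eq.
suff /eqmodP : repr (\pi_{eq_quot realization_equiv R cech_complex} p) =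
  p %[mod {eq_quot realization_equiv R cech_complex}] by [].
by rewrite reprK.
Qed.

Lemma cech_pre_projection_continuous : continuous cech_pre_projection.
Proof.
apply: sigT_cts => n.
apply: (@comp_cts _ (cech_complex n) _ fst
  (fun w : cech_complex n => val (projT2 w))); first exact: fst_cts.
apply: sigT_cts => a /=.
have := @initial_continuous (set_type (cech_inter a)) X set_val.
by rewrite set_valE.
Qed.

Lemma cech_projection_continuous : continuous cech_projection.
Proof.
apply/quotient_continuous.
rewrite (_ : _ \o _ = cech_pre_projection).
  exact: cech_pre_projection_continuous.
by apply/funext => p; exact: cech_projectionE.
Qed.

HB.instance Definition _ :=
  isContinuous.Build (realization R cech_complex) X cech_projection
    cech_projection_continuous.

End Cech.

(* Main.v *)
Require Import Defs.
From mathcomp Require Import all_boot all_order all_algebra.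
From mathcomp Require Import all_classical all_reals all_analysis.
From HB Require Import structures.
From Stdlib Require Import Relations.
From mathcomp Require Import generic_quotient ring lra.

(** Over each [U a] the projection [p] has the section [x |-> (vertex a at x)],
    and joining a point with this vertex deforms the part of the realization
    over [U a] fibrewise into the section.  The join is continuous because
    [U a] is open and the product of a quotient map with the compact interval
    is again a quotient map.

    Such a locally shrinkable map is a weak equivalence, by lifting maps from
    a compact [K].  A lift [s] of [g] already defined on an open set is extended
    over a small neighbourhood mapped into [U a] by moving [s t] for time
    [psi t] along the deformation, [psi] being a bump function: where [psi = 1]
    the result is the section at [g t], whatever [s t] was, and where [psi = 0]
    the lift is unchanged.  A prescribed lift over the boundary of a cube is
    first extended to a collar, by replacing [g] with its composite with a map
    that stretches an inner cube over the whole cube. *)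

Set Implicit Arguments.
Unset Strict Implicit.
Unset Printing Implicit Defensive.

Import Order.TTheory GRing.Theory Num.Theory.
Import numFieldNormedType.Exports.

Local Open Scope classical_set_scope.
Local Open Scope ring_scope.
Local Open Scope quotient_scope.

(** * Continuity at a point and open maps *)

Lemma cts_at_near_eq {S T : topologicalType} (f g : S -> T) (x : S) :
  (\near x, f x = g x) -> {for x, continuous f} -> {for x, continuous g}.
Proof.
move=> fg cf; have /= fgx := nbhs_singleton fg.
by move=> A; rewrite -fgx => /cf fA; apply: filterS2 fg fA => y /= ->.
Qed.

Lemma pair_cts_at {S T Z : topologicalType} (f : S -> T) (g : S -> Z) (x : S) :
  {for x, continuous f} -> {for x, continuous g} ->
  {for x, continuous (fun x => (f x, g x))}.
Proof. by move=> cf cg; exact: cvg_pair. Qed.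

Definition open_map {S T : topologicalType} (f : S -> T) :=
  forall x A, nbhs x A -> nbhs (f x) (f @` A).

Lemma open_map_comp {S T Z : topologicalType} (f : S -> T) (g : T -> Z) :
  open_map f -> open_map g -> open_map (g \o f).
Proof. by move=> of_ og x A /of_/og; rewrite image_comp. Qed.

Lemma open_map_pair {S T Z : topologicalType} (f : S -> T) :
  open_map f -> open_map (fun xz : S * Z => (f xz.1, xz.2)).
Proof.
move=> of_ [x z] A [[P Q] [/= nP nQ] PQA].
exists (f @` P, Q); first by split=> //=; exact: of_.
by move=> [_ u] [/= [s Ps <-] Qu]; exists (s, u) => //; exact: PQA.
Qed.

Lemma open_map_existT {I : choiceType} {S : I -> topologicalType} (i : I) :
  open_map (existT S i).
Proof. by move=> x A; exact: existT_nbhs. Qed.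

Lemma nbhs_set_type {S : topologicalType} {A : set S} (x : set_type A)
    (P : set (set_type A)) :
  nbhs x P -> exists2 O : set S, nbhs (val x) O &
    forall y : set_type A, O (val y) -> P y.
Proof.
move=> [_ [[V oV <-] Vx VP]]; rewrite set_valE in Vx VP.
by exists V => [|y Vy]; [exact: open_nbhs_nbhs | exact: VP].
Qed.

Lemma val_cts {S : topologicalType} (A : set S) :
  continuous (val : set_type A -> S).
Proof. by have := @initial_continuous (set_type A) S set_val; rewrite set_valE. Qed.

Lemma into_set_type_cts {S T : topologicalType} {A : set T}
    (f : S -> set_type A) :
  continuous (val \o f) -> continuous f.
Proof. by move=> cf; apply: continuous_comp_initial; rewrite set_valE. Qed.

Lemma open_map_val {S : topologicalType} (A : set S) :
  open A -> open_map (val : set_type A -> S).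
Proof.
move=> oA x P /nbhs_set_type[V nV VP].
have nA : nbhs (val x) A by apply: open_nbhs_nbhs; split=> //; exact: set_mem (valP x).
apply: filterS (filterI nA nV) => y [/mem_set Ay Vy].
by exists (exist _ y Ay) => //; exact: VP.
Qed.

(** Near-covering compactness passes to the subtype: a property of its points is read on [A] by
    quantifying over the membership proof. *)
Lemma set_type_compact {S : topologicalType} (A : set S) :
  compact A -> compact [set: set_type A].
Proof.
move=> /compact_near_coveringP/near_covering_withinP cA.
apply/compact_near_coveringP => I F P FF H.
suff : \near F, A `<=` (fun x => forall Ax : x \in A, P F (exist _ x Ax)).
  by apply: filterS => i AP [x Ax] _; apply: AP; exact: set_mem.
apply: cA => x Ax.
have [[M N] [/= /nbhs_set_type[V nV VM] nN] MN] := H (exist _ x (mem_set Ax)) Logic.I.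
exists (V, N) => // -[y i] [/= Vy Ni] _ Ay; apply: (MN (_, i)); split=> //.
exact: VM.
Qed.

(** Continuity descends along an open map, since images of neighbourhoods of [x] are neighbourhoods
    of [e x]. Functions with junk values are thus tested on open charts where they have a single
    formula. *)
Lemma cts_at_open_map {S T Z : topologicalType} (e : S -> T) (f : T -> Z) (x : S) :
  open_map e -> {for x, continuous (f \o e)} -> {for e x, continuous f}.
Proof. by move=> oe cf A /cf /oe; apply: filterS => _ [y fA <-]. Qed.

Lemma rV_cts_at {S : topologicalType} {T : topologicalType} n (f : S -> 'rV[T]_n) (x : S) :
  (forall i, {for x, continuous (fun y => f y 0 i)}) -> {for x, continuous f}.
Proof.
move=> cf A [B fB BA]; rewrite /= nbhs_simpl /=.
have : \near x, forall i, B 0 i (f x 0 i).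
  by apply: filter_forall => i; apply: (cf i); exact: fB.
by apply: filterS => y By; apply: BA => i j; rewrite (ord1 i); exact: By.
Qed.

(* J. H. C. Whitehead: the product of a quotient map with a locally compact
   space is again a quotient map. *)
Lemma cts_at_quotient_prod {T K Z : topologicalType} {Q0 : quotType T}
    (O : set (quotient_topology Q0)) (F : quotient_topology Q0 * K -> Z) :
  (forall (k : K) A, nbhs k A ->
     exists C, [/\ nbhs k C, compact C & C `<=` A]) ->
  open O ->
  (forall w k, O (\pi_(quotient_topology Q0) w) ->
     {for (w, k), continuous
        (fun wk : T * K => F (\pi_(quotient_topology Q0) wk.1, wk.2))}) ->
  forall y k, O y -> {for (y, k), continuous F}.
Proof.
move=> Kc oO cF y k Oy B.
rewrite nbhsE => -[N [oN NF] NB].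
have Ow : O (\pi_(quotient_topology Q0) (repr y)) by rewrite reprK.
have /= := cF (repr y) k Ow N; rewrite reprK => /(_ (open_nbhs_nbhs (conj oN NF))).
move=> [[P C0] [/= nP nC0] PC].
have [C [nC cC CC0]] := Kc k C0 nC0.
(* The tube around [C]. Its preimage in [T] is open because compactness of [C] turns the local
   conditions along a slice into one neighbourhood of the base point. *)
pose M := [set y' | O y' /\ forall k', C k' -> N (F (y', k'))].
have oM : open M.
  rewrite /open /= /quotient_open openE => w [Ow' NC].
  have nO : nbhs w (\pi_(quotient_topology Q0) @^-1` O).
    exact: (@pi_continuous _ Q0) (open_nbhs_nbhs (conj oO Ow')).
  suff : \near w, C `<=` (fun k' => N (F (\pi_(quotient_topology Q0) w, k'))).
    by apply: filterS2 nO => w' Ow'' NC'.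
  move/compact_near_coveringP : cC; apply => k' Ck'.
  have [[V W] [/= nV nW] VW] := cF w k' Ow' N (open_nbhs_nbhs (conj oN (NC _ Ck'))).
  by exists (W, V) => // -[k1 w1] [/= ? ?]; exact: (VW (w1, k1)).
exists (M, C); first split=> //=.
  apply: open_nbhs_nbhs; split=> //; split=> // k' /CC0 Ck'.
  by have := PC (repr y, k') (conj (nbhs_singleton nP) Ck'); rewrite /= reprK.
by move=> [y' k'] [/= [_ NC] /NC]; exact: NB.
Qed.

(** Complements of sets satisfying [Q] form a filter. The near-covering property, applied to this
    filter and the relation [x <> i], puts the complement of [S] in it. *)
Lemma compact_ind {K : topologicalType} (Q : set K -> Prop) (S : set K) :
  compact S -> Q set0 -> (forall V W, V `<=` W -> Q W -> Q V) ->
  (forall V W, Q V -> Q W -> Q (V `|` W)) ->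
  (forall x, S x -> exists2 W, nbhs x W & Q W) -> Q S.
Proof.
move=> /compact_near_coveringP cS Q0 QS QU Qloc.
have FF : Filter [set V | Q (~` V)].
  split=> /=; first by rewrite setCT.
    by move=> V W /= QV QW; rewrite setCI; exact: QU.
  by move=> V W VW; apply: QS; exact: subsetC.
have /QS : Q (~` [set i | S `<=` (fun x => x <> i)]).
  apply: (cS K [set V | Q (~` V)] (fun i x => x <> i)) => x /Qloc[W nW QW].
  exists (W, ~` W); first by split=> //; rewrite /nbhs /= setCK.
  by move=> [y i] [/= Wy nWi] yi; apply: nWi; rewrite -yi.
by apply=> i Si /(_ i Si).
Qed.

(** * Lifting along a locally shrinkable map *)

Section PartialLift.
Context (R : realType).
Local Notation I := (unit_interval R).

(** The function is one on an open set, not just at [t], and its support lies in [N]. The last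
    clause states the latter pointwise, as it is used in gluing. *)
Definition bump_space (K : topologicalType) :=
  forall (t : K) (N : set K), nbhs t N ->
  exists (psi : K -> I) (W : set K),
    [/\ continuous psi, open W, W t, forall u, W u -> psi u = one &
        forall u, N u \/ \near u, psi u = zero].

Context {X Y : topologicalType} (p : Y -> X) {A : choiceType} (U : A -> set X).

(** Over each [U a] the map [p] is shrinkable: [v a] is a section and [J a] a
    fibrewise deformation of the identity into that section.  Both are total
    functions with junk values away from [U a]. *)
Record shrinking (v : A -> X -> Y) (J : A -> Y * I -> Y) : Prop := Shrinking {
  section_cts : forall a x, U a x -> {for x, continuous (v a)};
  sectionK : forall a x, U a x -> p (v a x) = x;
  deform_cts : forall a y s, U a (p y) -> {for (y, s), continuous (J a)};
  deform_over : forall a y s, U a (p y) -> p (J a (y, s)) = p y;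
  deform0 : forall a y, J a (y, zero) = y;
  deform1 : forall a y, U a (p y) -> J a (y, one) = v a (p y)
}.

Context (v : A -> X -> Y) (J : A -> Y * I -> Y) (vJ : shrinking v J).
Hypothesis U_open : forall a, open (U a).
Hypothesis U_cover : \bigcup_(a in [set: A]) U a = [set: X].

Section Lift.
Context {K : topologicalType} (g : K -> X) (g_cts : continuous g).

(** The function is total, with arbitrary values off [D]. For open [D], continuity at the points of
    [D] amounts to continuity on the subspace. *)
Definition partial_lift (D : set K) (s : K -> Y) :=
  forall t, D t -> {for t, continuous s} /\ p (s t) = g t.

(** Near each point of [D] or [W] the new lift is given by one formula: [v a] after [g] on [W],
    [J a (s u, psi u)] at points of [D] over [U a], and [s] itself where [psi] vanishes nearby. *)
Lemma partial_lift_step (a : A) (psi : K -> I) (D W : set K) (s : K -> Y) :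
  continuous psi -> open D -> open W -> (forall t, W t -> psi t = one) ->
  (forall t, U a (g t) \/ \near t, psi t = zero) -> partial_lift D s ->
  exists2 s', partial_lift (D `|` W) s' & forall t, psi t = zero -> s' t = s t.
Proof.
move=> cpsi oD oW W1 Usupp lift_s.
have one_neq0 : (one : I) <> zero by apply/eqP; rewrite eq_sym zero_one_neq.
pose s' t := if psi t == one then v a (g t)
  else if `[< U a (g t) >] then J a (s t, psi t) else s t.
have nearU t : U a (g t) -> \near t, U a (g t).
  by move=> Ut; apply: g_cts; exact: open_nbhs_nbhs.
have s'0 t : psi t = zero -> s' t = s t.
  move=> p0; rewrite /s' p0 eq_sym; case: eqP => [|_]; first by move/one_neq0.
  by case: ifP => // _; rewrite (deform0 vJ).
(* By [deform1] the section branch agrees with [J] at time one, so a single continuous expression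
   covers both branches here. *)
have s'J t : D t -> U a (g t) -> s' t = J a (s t, psi t).
  move=> Dt Ut; have [_ pst] := lift_s t Dt.
  rewrite /s'; case: eqP => [->|_]; last by rewrite asboolT.
  by rewrite (deform1 vJ) ?pst.
have s'V t : W t -> s' t = v a (g t) by move=> Wt; rewrite /s' W1 // eqxx.
exists s' => // t [Dt|Wt].
- have [cs ps] := lift_s t Dt; have nD : nbhs t D by exact: open_nbhs_nbhs.
  have [Ut|near0] := Usupp t; last first.
    have nss' : \near t, s t = s' t by apply: filterS near0 => u /s'0 ->.
    split; first exact: cts_at_near_eq nss' cs.
    by rewrite s'0 //; exact: (nbhs_singleton near0).
  split; last by rewrite s'J // (deform_over vJ) ps.
  apply: (@cts_at_near_eq _ _ (fun u => J a (s u, psi u))).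
    by apply: filterS2 nD (nearU t Ut) => u Du Uu; rewrite s'J.
  apply: (@continuous_comp _ _ _ (fun u => (s u, psi u))).
    exact: pair_cts_at cs (cpsi t).
  by apply: (deform_cts vJ); rewrite ps.
- have Ut : U a (g t).
    have [//|/nbhs_singleton /= p0] := Usupp t.
    by case: one_neq0; rewrite -(W1 t Wt).
  split; last by rewrite s'V // (sectionK vJ).
  apply: (@cts_at_near_eq _ _ (v a \o g)).
    have : nbhs t W by exact: open_nbhs_nbhs.
    by apply: filterS => u Wu; rewrite s'V.
  by apply: continuous_comp; [exact: g_cts | exact: (section_cts vJ)].
Qed.

(** Compact induction over the complement of [D], with bumps supported off [B] so that no step
    changes the values on [B]. *)
Lemma partial_lift_extend (D B : set K) (s : K -> Y) :
  compact [set: K] -> bump_space K -> open D -> closed B -> B `<=` D ->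
  partial_lift D s ->
  exists s' : K -> Y,
    [/\ continuous s', forall t, p (s' t) = g t & forall t, B t -> s' t = s t].
Proof.
move=> cK bK oD cB BD lift_s.
(* Quantifying over every partial lift makes extensibility stable under unions: extend over the
   first set, then extend the result over the second. *)
pose extensible W := forall D' s', open D' -> partial_lift D' s' ->
  exists2 s'', partial_lift (D' `|` W) s'' & forall t, B t -> s'' t = s' t.
have : exists W, [/\ open W, ~` D `<=` W & extensible W].
  pose Q S := exists W, [/\ open W, S `<=` W & extensible W].
  apply: (@compact_ind _ Q).
  - by apply: subclosed_compact cK _ => //; rewrite closedC.
  - exists set0; split=> //; first exact: open0.
    by move=> D' s' _ ls'; exists s' => //; rewrite setU0.
  - by move=> S T ST [W [oW TW eW]]; exists W; split=> //; exact: subset_trans TW.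
  - move=> S T [W [oW SW eW]] [W' [oW' TW' eW']].
    exists (W `|` W'); split; [exact: openU | exact: setUSS |].
    move=> D' s' oD' ls'; have [s1 ls1 s1E] := eW _ _ oD' ls'.
    have [s2 ls2 s2E] := eW' _ _ (openU oD' oW) ls1.
    by exists s2; [rewrite setUA | move=> t Bt; rewrite s2E // s1E].
  - move=> t nDt.
    have [a _ Ut] : (\bigcup_(a in [set: A]) U a) (g t) by rewrite U_cover.
    (* Since [B] lies in [D] and [t] does not, [t] has a neighbourhood that avoids [B]. *)
    have nN : nbhs t (g @^-1` U a `&` ~` B).
      apply: filterI; first by apply: g_cts; exact: open_nbhs_nbhs.
      by apply: open_nbhs_nbhs; split; [rewrite openC | move/BD].
    have [psi [W [cpsi oW Wt W1 supp]]] := bK t _ nN.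
    exists W; first exact: open_nbhs_nbhs.
    exists W; split=> // D' s' oD' ls'.
    have [|s'' ls'' s''E] := partial_lift_step cpsi oD' oW W1 _ ls' (a := a).
      by move=> u; case: (supp u) => [[]|]; [left|right].
    exists s'' => // u Bu; apply: s''E.
    by case: (supp u) => [[_ /(_ Bu)]//|/nbhs_singleton].
move=> [W [oW DW /(_ D s oD lift_s) [s' ls' s'E]]].
have all_t t : (D `|` W) t.
  by have [|/DW] := pselect (D t); [left|right].
exists s'; split=> // t; first by have [] := ls' t (all_t t).
by have [] := ls' t (all_t t).
Qed.

End Lift.
End PartialLift.

(** * Bump functions and stretching on cubes *)

Section Domains.
Context {R : realType}.
Local Notation I := (unit_interval R).

Lemma to_interval_ge1 (x : R) : 1 <= x -> to_interval x = one.
Proof.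
move=> x1; apply: val_inj; rewrite interval_val1 /= /clamp.
by rewrite (min_idPl x1) (max_idPr ler01).
Qed.

Lemma to_interval_le0 (x : R) : x <= 0 -> to_interval x = zero.
Proof.
move=> x0; apply: val_inj; rewrite interval_val0 /= /clamp.
by rewrite (max_idPl _) // ge_min x0 orbT.
Qed.

Lemma near_lt {K : topologicalType} (f : K -> R) (x : K) (a : R) :
  {for x, continuous f} -> f x < a -> \near x, f x < a.
Proof. by move=> cf xa; exact: (cf _ (lt_nbhsl xa)). Qed.

Lemma near_gt {K : topologicalType} (f : K -> R) (x : K) (a : R) :
  {for x, continuous f} -> a < f x -> \near x, a < f x.
Proof.
by move=> cf ax; apply: (cf [set y | a < y]); apply: open_nbhs_nbhs; split.
Qed.

Lemma dist_cts {V : normedModType R} {K : topologicalType} (i : K -> V) (x : V) :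
  continuous i -> continuous (fun u => `|i u - x|).
Proof.
by move=> ci u; apply: cvg_norm; apply: cvgB; [exact: ci | exact: cvg_cst].
Qed.

(** The hypotheses say that the topology of [K] is induced by [i], so a function of the distance to
    [i t] serves as bump. *)
Lemma bump_space_embed (V : normedModType R) (K : topologicalType) (i : K -> V) :
  continuous i ->
  (forall t N, nbhs t N -> exists2 e : R, 0 < e &
     forall u, `|i u - i t| < e -> N u) ->
  bump_space R K.
Proof.
move=> ci iN t N /iN[e e0 eN].
have cd := dist_cts (x := i t) ci.
(* After clamping, this is one at distance at most [e / 2] and zero from distance [3 * e / 4] on;
   the gap up to [e] makes it vanish near every point outside [N]. *)
exists (fun u => to_interval (3 - 4 / e * `|i u - i t|)).
exists [set u | `|i u - i t| < e / 2]; split.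
- apply: comp_cts to_interval_continuous => u.
  by apply: cvgB; [exact: cvg_cst | apply: cvgM; [exact: cvg_cst | exact: cd]].
- rewrite openE => u; exact: near_lt (cd u).
- by rewrite /= subrr normr0 divr_gt0.
- move=> u /= ue; apply: to_interval_ge1.
  have : 4 / e * `|i u - i t| <= 4 / e * (e / 2).
    by rewrite ler_pM2l ?divr_gt0 //; exact: ltW.
  have -> : 4 / e * (e / 2) = 2 by field; rewrite gt_eqF.
  by move=> ?; lra.
- move=> u; have [/eN|ue] := ltP `|i u - i t| e; first by left.
  right; have : \near u, e * (3 / 4) < `|i u - i t|.
    by apply: near_gt; [exact: cd | lra].
  apply: filterS => w ew; apply: to_interval_le0.
  have : 4 / e * (e * (3 / 4)) <= 4 / e * `|i w - i t|.
    by rewrite ler_pM2l ?divr_gt0 //; exact: ltW.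
  have -> : 4 / e * (e * (3 / 4)) = 3 by field; rewrite gt_eqF.
  by move=> ?; lra.
Qed.

Lemma bump_space_set_type (V : normedModType R) (S : set V) :
  bump_space R (set_type S).
Proof.
apply: (@bump_space_embed V (set_type S) val); first exact: val_cts.
move=> t N /nbhs_set_type[W /nbhs_ballP[e e0 eW] WN]; exists e => // u ue.
by apply/WN/eW; rewrite -ball_normE /= distrC.
Qed.

Lemma bump_space_prod (K L : topologicalType) :
  bump_space R K -> bump_space R L -> bump_space R (K * L)%type.
Proof.
move=> bK bL [t s] N [[P Q] [/= nP nQ] PQN].
have [psi [W [cpsi oW Wt W1 supp]]] := bK t P nP.
have [phi [V [cphi oV Vs V1 supp']]] := bL s Q nQ.
exists (fun ts => to_interval (val (psi ts.1) * val (phi ts.2))), (W `*` V).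
split=> //.
- apply: comp_cts to_interval_continuous => ts; apply: cvgM.
    exact: (comp_cts (comp_cts fst_cts cpsi) interval_val_continuous).
  exact: (comp_cts (comp_cts snd_cts cphi) interval_val_continuous).
- rewrite openE => -[w u] [/= Ww Vu].
  by exists (W, V) => //=; split; exact: open_nbhs_nbhs.
- move=> [w u] [/= Ww Vu]; rewrite W1 // V1 // interval_val1 mulr1.
  exact: to_interval_ge1.
- move=> [w u]; have [Pw|p0] := supp w.
    have [Qu|q0] := supp' u; first by left; exact: PQN.
    right; exists (setT, [set u | phi u = zero]); first by split=> //; exact: filterT.
    move=> [? ?] [/= _ ->]; rewrite interval_val0 mulr0; exact: to_interval_le0.
  right; exists ([set w | psi w = zero], setT); first by split=> //; exact: filterT.
  move=> [? ?] [/= -> _]; rewrite interval_val0 mul0r; exact: to_interval_le0.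
Qed.

Lemma bump_space_interval : bump_space R I.
Proof. exact: (@bump_space_set_type R^o). Qed.

Lemma bump_space_cube n : bump_space R (cube R n).
Proof. exact: bump_space_set_type. Qed.

Lemma interval_compact : compact [set: I].
Proof. by apply: set_type_compact; exact: segment_compact. Qed.

Lemma cube_compact n : compact [set: cube R n].
Proof.
apply: set_type_compact.
have := @rV_compact R n (fun=> `[0, 1]%classic) (fun=> @segment_compact R 0 1).
congr compact; apply/seteqP; split=> t /= ht i; have := ht i; rewrite ?in_itv //=.
Qed.

(** Sends the middle third affinely onto the unit interval and collapses the outer thirds to its end
    points. *)
Definition stretch (x : R) : R := clamp (3 * x - 1).

Lemma to_interval_stretch_continuous :
  continuous (fun x : R => to_interval (3 * x - 1)).
Proof.
apply: comp_cts to_interval_continuous => x.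
by apply: cvgB; [apply: cvgM; [exact: cvg_cst | exact: cvg_id] | exact: cvg_cst].
Qed.

Lemma stretch_continuous : continuous stretch.
Proof.
exact: comp_cts to_interval_stretch_continuous interval_val_continuous.
Qed.

Lemma stretch_itv x : 0 <= stretch x <= 1.
Proof. exact: (interval_val (to_interval _)). Qed.

Lemma stretch_le x : x <= 3^-1 -> stretch x = 0.
Proof.
move=> x3; have := to_interval_le0 (x := 3 * x - 1).
by move=> /(_ _)/(congr1 val); rewrite interval_val0 /=; apply; lra.
Qed.

Lemma stretch_ge x : 2 / 3 <= x -> stretch x = 1.
Proof.
move=> x3; have := to_interval_ge1 (x := 3 * x - 1).
by move=> /(_ _)/(congr1 val); rewrite interval_val1 /=; apply; lra.
Qed.

(** * Stretching an inner cube over the whole cube *)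

Section CubeStretch.
Context {n : nat}.

Lemma cube_stretch_subproof (ts : cube R n * I) :
  \row_i ((1 - val ts.2) * val ts.1 0 i + val ts.2 * stretch (val ts.1 0 i)) \in
    [set t : 'rV[R]_n | forall i, 0 <= t 0 i <= 1].
Proof.
apply/mem_set => i; rewrite mxE.
have /andP[t0 t1] := set_mem (valP ts.1) i.
have /andP[s0 s1] := interval_val ts.2.
have /andP[x0 x1] := stretch_itv (val ts.1 0 i).
by apply/andP; split; nra.
Qed.

(** The straight-line homotopy from the identity to the coordinatewise [stretch]. *)
Definition cube_stretch (ts : cube R n * I) : cube R n :=
  exist _ (\row_i ((1 - val ts.2) * val ts.1 0 i + val ts.2 * stretch (val ts.1 0 i)))
    (cube_stretch_subproof ts).

Lemma cube_stretchE t s i : val (cube_stretch (t, s)) 0 i =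
  (1 - val s) * val t 0 i + val s * stretch (val t 0 i).
Proof. by rewrite mxE. Qed.

Lemma coord_cts (i : 'I_n) : continuous (fun t : cube R n => val t 0 i).
Proof. apply: comp_cts (@coord_continuous R 1 n 0 i); exact: val_cts. Qed.

Lemma cube_stretch_continuous : continuous cube_stretch.
Proof.
apply: into_set_type_cts => ts; apply: rV_cts_at => i.
have -> : (fun ts => (val \o cube_stretch) ts 0 i) = (fun ts : cube R n * I =>
    (1 - val ts.2) * val ts.1 0 i + val ts.2 * stretch (val ts.1 0 i)).
  by apply/funext => us; rewrite /= mxE.
have cs : continuous (fun ts : cube R n * I => val ts.2).
  exact: comp_cts snd_cts interval_val_continuous.
have ct : continuous (fun ts : cube R n * I => val ts.1 0 i).
  by apply: comp_cts (coord_cts (i := i)); exact: fst_cts.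
apply: cvgD; apply: cvgM; [apply: cvgB; [exact: cvg_cst | exact: cs]|exact: ct|exact: cs|].
exact: (comp_cts ct stretch_continuous).
Qed.

Lemma cube_stretch0 t : cube_stretch (t, zero) = t.
Proof.
by apply/val_inj/rowP => i; rewrite cube_stretchE interval_val0 subr0 mul1r mul0r addr0.
Qed.

Lemma cube_stretch_boundary t s :
  cube_boundary t -> cube_boundary (cube_stretch (t, s)).
Proof.
move=> [i ti]; exists i; rewrite cube_stretchE; case: ti => ->.
  by left; rewrite stretch_le ?invr_ge0 // !mulr0 addr0.
by right; rewrite stretch_ge; [ring | lra].
Qed.

Definition collar : set (cube R n) :=
  [set t : cube R n | exists i, val t 0 i < 3^-1 \/ 2 / 3 < val t 0 i].

Lemma collar_open : open collar.
Proof.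
rewrite openE => t [i ti].
have ct : {for t, continuous (fun u : cube R n => val u 0 i)} by exact: coord_cts.
case: ti => ti.
  by apply: filterS (near_lt ct ti) => u; exists i; left.
by apply: filterS (near_gt ct ti) => u; exists i; right.
Qed.

Lemma collar_boundary : @cube_boundary R n `<=` collar.
Proof. by move=> t [i ti]; exists i; case: ti => ->; [left|right]; lra. Qed.

(** Composing with the stretch thus makes a based map constant on an open neighbourhood of the
    boundary, as needed to start from a lift over an open set. *)
Lemma collar_stretch t : collar t -> cube_boundary (cube_stretch (t, one)).
Proof.
move=> [i ti]; exists i; rewrite cube_stretchE interval_val1 subrr mul0r add0r mul1r.
by case: ti => /ltW ti; [left; exact: stretch_le | right; exact: stretch_ge].
Qed.

Lemma cube_boundary_closed : closed (@cube_boundary R n).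
Proof.
rewrite (_ : @cube_boundary R n = \bigcup_(i in [set: 'I_n])
    ((fun t : cube R n => val t 0 i) @^-1` [set 0; 1])).
  apply: closed_bigcup => [|i _]; first exact: finite_finset.
  apply: preimage_closed => [t _|]; first exact: coord_cts.
  by apply: closedU; exact: closed_eq.
by apply/seteqP; split=> [t [i ti]|t [i _ ti]]; exists i.
Qed.

End CubeStretch.

End Domains.

(** * Locally shrinkable maps are weak equivalences *)

Lemma inj_surj_bijective {S T : Type} (f : S -> T) :
  injective f -> (forall y, exists x, f x = y) -> bijective f.
Proof.
move=> fI /choice[h fh]; exists h => // x; exact/fI/fh.
Qed.

Section BasedMaps.
Context {R : realType} {Y : topologicalType} {n : nat} {y : Y}.
Local Notation I := (unit_interval R).

Lemma based_cube_mapP (g : cube R n -> Y) :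
  continuous g -> (forall t, cube_boundary t -> g t = y) ->
  exists b : based_cube_map R n y, val b = g :> (cube R n -> Y).
Proof.
move=> cg gy.
by exists (exist _ (mkcts cg : continuousType _ _) (mem_set gy)).
Qed.

Lemma based_cube_map_boundary (b : based_cube_map R n y) t :
  cube_boundary t -> val b t = y.
Proof. exact: (set_mem (valP b)). Qed.

Lemma homotopy_classP (b c : based_cube_map R n y) :
  homotopy_class b = homotopy_class c <->
  homotopic_rel R (@cube_boundary R n) (val b) (val c).
Proof. by split=> [/eqmodP/asboolP|bc] //; apply/eqmodP/asboolP. Qed.

Lemma homotopy_class_surj (c : homotopy_group R n y) :
  exists b, homotopy_class b = c.
Proof. by exists (repr (c : {eq_quot @based_homotopic_equiv R Y n y})); exact: reprK. Qed.

(** The stretching homotopy keeps the boundary inside itself, where [b] is constant, so it is a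
    homotopy relative to the boundary. *)
Lemma homotopy_class_stretch (b : based_cube_map R n y) :
  exists2 c : based_cube_map R n y, homotopy_class b = homotopy_class c &
    forall t, val c t = val b (cube_stretch (t, one)).
Proof.
have cb : continuous (fun ts : cube R n * I => val b (cube_stretch ts)).
  exact: comp_cts cube_stretch_continuous (@cts_fun _ _ (val b)).
have c1 : continuous (fun t : cube R n => val b (cube_stretch (t, one))).
  apply: comp_cts cb; apply: pair_cts; first by move=> t; exact: cvg_id.
  exact: cst_continuous.
have [c cE] := based_cube_mapP c1 (fun t tB =>
  based_cube_map_boundary b (cube_stretch_boundary one tB)).
exists c; last by move=> t; rewrite cE.
apply/homotopy_classP; exists (mkcts cb); split=> [t|t|t s tB]; rewrite /mkcts.
- exact: (congr1 (val b) (cube_stretch0 t)).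
- by rewrite cE.
- rewrite (based_cube_map_boundary b tB).
  exact: (based_cube_map_boundary b (cube_stretch_boundary s tB)).
Qed.

End BasedMaps.

Section ShrinkingWeakEquivalence.
Context {R : realType} {X Y : topologicalType} (p : continuousType Y X).
Context {A : choiceType} (U : A -> set X) (v : A -> X -> Y)
  (J : A -> Y * unit_interval R -> Y) (vJ : shrinking p U v J).
Hypothesis U_open : forall a, open (U a).
Hypothesis U_cover : \bigcup_(a in [set: A]) U a = [set: X].
Local Notation I := (unit_interval R).

Let zero_le0 : val (zero : I) <= 0. Proof. by rewrite interval_val0. Qed.
Let one_ge1 : 1 <= val (one : I). Proof. by rewrite interval_val1. Qed.

Section Steps.
Context {K : topologicalType} (y0 y1 : K -> Y) (s : K -> I).
Hypotheses (cy0 : continuous y0) (cy1 : continuous y1) (cs : continuous s).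

(** Prescribes both ends of a lifted homotopy by one function. Its possible jump at one half lies
    outside [ends]. *)
Definition step (k : K) : Y := if val (s k) <= 2^-1 then y0 k else y1 k.

Definition ends : set K := [set k | val (s k) < 3^-1 \/ 2 / 3 < val (s k)].

Let cvs : continuous (fun k => val (s k)).
Proof. exact: comp_cts cs interval_val_continuous. Qed.

Lemma ends_open : open ends.
Proof.
rewrite openE => k [ks|ks].
  by apply: filterS (near_lt (@cvs k) ks) => k'; left.
by apply: filterS (near_gt (@cvs k) ks) => k'; right.
Qed.

Lemma step_cts k : ends k -> {for k, continuous step}.
Proof.
move=> [ks|ks].
  apply: (@cts_at_near_eq _ _ y0); last exact: cy0.
  by apply: filterS (near_lt (@cvs k) ks) => k' ?; rewrite /step ifT //; lra.
apply: (@cts_at_near_eq _ _ y1); last exact: cy1.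
by apply: filterS (near_gt (@cvs k) ks) => k' ?; rewrite /step ifF //; apply/negbTE; lra.
Qed.

(** The reparametrization [3 * s - 1] makes [H] stationary on the outer thirds, so [y0] and [y1]
    lift it there and not only at the end times. *)
Lemma step_lift (H : K * I -> X) k :
  (forall k, H (k, zero) = p (y0 k)) -> (forall k, H (k, one) = p (y1 k)) ->
  ends k -> p (step k) = H (k, to_interval (3 * val (s k) - 1)).
Proof.
move=> H0 H1 [ks|ks]; rewrite /step.
  have -> : val (s k) <= 2^-1 by lra.
  by rewrite to_interval_le0 ?H0 //; lra.
have /negbTE -> : ~~ (val (s k) <= 2^-1) by lra.
by rewrite to_interval_ge1 ?H1 //; lra.
Qed.

End Steps.

Lemma shrinking_path (y0 y1 : Y) :
  path_connected R (p y0) (p y1) -> path_connected R y0 y1.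
Proof.
move=> /path_connectedP[g cg [g0 g1]].
have cid : continuous (@id I) by move=> s; exact: cvg_id.
have cstep := step_cts (@cst_continuous I Y y0) (@cst_continuous I Y y1) cid.
have cg' : continuous (fun s : I => g (to_interval (3 * val s - 1))).
  apply: comp_cts cg; exact: comp_cts interval_val_continuous to_interval_stretch_continuous.
(* The two end points of the interval, written as inequalities to get closedness from continuity of
   [val]. *)
have cB : closed ([set s : I | val s <= 0] `|` [set s : I | 1 <= val s]).
  apply: closedU.
    by apply: (preimage_closed _ (@closed_le R 0)) => s _; exact: interval_val_continuous.
  by apply: (preimage_closed _ (@closed_ge R 1)) => s _; exact: interval_val_continuous.
have [||||s [cs _ sE]] := partial_lift_extend vJ U_open U_cover cg'
    (D := ends id) (B := [set s : I | val s <= 0] `|` [set s : I | 1 <= val s])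
    (s := step (cst y0) (cst y1) id) interval_compact bump_space_interval.
- exact: ends_open.
- exact: cB.
- by move=> s [] /= ?; [left|right] => /=; lra.
- move=> s sD; split; first exact: cstep.
  by rewrite (step_lift (H := g \o snd) _ _ sD).
apply/path_connectedP; exists s => //; split.
  rewrite sE /step ?interval_val0 ?invr_ge0 ?ler0n //.
  by left; exact: zero_le0.
rewrite sE /step ?interval_val1; last by right; exact: one_ge1.
by rewrite ifF //; apply/negbTE; lra.
Qed.

(** Path lifting gives injectivity; the local sections give surjectivity. *)
Lemma shrinking_pi0 : bijective (@pi0_map R Y X p).
Proof.
apply: inj_surj_bijective => [c d|].
  rewrite -(reprK (c : {eq_quot @path_connected_equiv R Y})).
  rewrite -(reprK (d : {eq_quot @path_connected_equiv R Y})).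
  rewrite !pi0_mapE => /eqmodP /= pcd.
  by apply/eqmodP; exact: shrinking_path.
move=> c; rewrite -(reprK (c : {eq_quot @path_connected_equiv R X})).
set x := repr _; have [a _ Ux] : (\bigcup_(a in [set: A]) U a) x by rewrite U_cover.
by exists (pi0_class R (v a x)); rewrite pi0_mapE (sectionK vJ).
Qed.

(** After stretching, the representative is constant on the collar, so the constant map at [y] lifts
    it there, and the extension keeps the value [y] on the boundary. *)
Lemma shrinking_pin_surj n (y : Y) (c : homotopy_group R n (p y)) :
  exists d, homotopy_group_map (R := R) p d = c.
Proof.
have [b <-] := homotopy_class_surj c.
have [b' -> b'E] := homotopy_class_stretch b.
have [||||g [cg pg gE]] := partial_lift_extend vJ U_open U_cover (@cts_fun _ _ (val b'))
    (D := collar) (B := @cube_boundary R n) (s := cst y) (cube_compact (n := n))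
    (bump_space_cube (n := n)).
- exact: collar_open.
- exact: cube_boundary_closed.
- exact: collar_boundary.
- move=> t tD; split; first exact: cst_continuous.
  by rewrite b'E based_cube_map_boundary //; exact: collar_stretch.
have [d dE] := based_cube_mapP cg gE.
exists (homotopy_class d); rewrite homotopy_group_mapE; congr homotopy_class.
by apply/val_inj/continuousEP => t; rewrite /= dE pg.
Qed.

(** A homotopy downstairs is lifted over the prism, with the lift prescribed on the sides and at
    both ends. Stretching in the cube and in time makes the prescribed lift live on an open set. *)
Lemma shrinking_pin_inj n (y : Y) :
  injective (@homotopy_group_map R Y X p n y).
Proof.
move=> c d; have [b0 <-] := homotopy_class_surj c.
have [b1 <-] := homotopy_class_surj d.
rewrite !homotopy_group_mapE => /homotopy_classP[H [/= H0 H1 HB]].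
have [b0' -> b0E] := homotopy_class_stretch b0.
have [b1' -> b1E] := homotopy_class_stretch b1.
pose q (t : cube R n) := cube_stretch (t, one : I).
have cq : continuous q.
  apply: comp_cts cube_stretch_continuous; apply: pair_cts.
    by move=> t; exact: cvg_id.
  exact: cst_continuous.
pose g (ts : cube R n * I) := H (q ts.1, to_interval (3 * val ts.2 - 1)).
have cg : continuous g.
  apply: comp_cts (@cts_fun _ _ H); apply: pair_cts; first exact: comp_cts fst_cts cq.
  exact: comp_cts (comp_cts snd_cts interval_val_continuous)
    to_interval_stretch_continuous.
have cb0 : continuous (fun ts : cube R n * I => val b0' ts.1).
  exact: comp_cts fst_cts (@cts_fun _ _ (val b0')).
have cb1 : continuous (fun ts : cube R n * I => val b1' ts.1).
  exact: comp_cts fst_cts (@cts_fun _ _ (val b1')).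
pose e := step (fun ts : cube R n * I => val b0' ts.1)
  (fun ts => val b1' ts.1) snd.
(* Both representatives equal [y] over the collar, so the jump of [e] at time one half disappears
   there. *)
have e_collar ts : collar ts.1 -> e ts = y.
  move=> tD; rewrite /e /step b0E b1E !based_cube_map_boundary ?if_same //;
    exact: collar_stretch.
pose B := (fst @^-1` @cube_boundary R n) `|` ([set ts : cube R n * I | val ts.2 <= 0] `|`
  [set ts : cube R n * I | 1 <= val ts.2]).
have cvs : continuous (fun ts : cube R n * I => val ts.2).
  exact: comp_cts snd_cts interval_val_continuous.
have cB : closed B.
  apply: closedU.
    by apply: preimage_closed cube_boundary_closed => ts _; exact: fst_cts.
  apply: closedU.
    by apply: (preimage_closed _ (@closed_le R 0)) => ts _; exact: cvs.
  by apply: (preimage_closed _ (@closed_ge R 1)) => ts _; exact: cvs.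
have [||||||L [cL _ LE]] := partial_lift_extend vJ U_open U_cover cg
    (D := (fst @^-1` collar) `|` ends snd) (B := B) (s := e).
- have := compact_setX (@cube_compact R n) (@interval_compact R).
  by congr compact; apply/seteqP; split.
- exact: bump_space_prod (@bump_space_cube R n) (@bump_space_interval R).
- apply: openU; last by apply: ends_open; exact: snd_cts.
  by apply: open_comp; [move=> ts _; exact: fst_cts | exact: collar_open].
- exact: cB.
- move=> ts [/collar_boundary ?|]; first by left.
  by move=> [] /= ?; right; [left|right] => /=; lra.
- move=> ts [tD|sD].
    have nD : \near ts, collar ts.1.
      by apply: fst_cts; apply: open_nbhs_nbhs; split=> //; exact: collar_open.
    split.
      apply: (@cts_at_near_eq _ _ (cst y)); last exact: cst_continuous.
      by apply: filterS nD => us /e_collar ->.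
    have qB := collar_stretch tD.
    by rewrite e_collar // /g HB // based_cube_map_boundary.
  split; first by apply: step_cts sD => //; exact: snd_cts.
  rewrite /e (step_lift (H := fun ts => H (q ts.1.1, ts.2)) _ _ sD) //.
    by move=> us /=; rewrite H0 b0E.
  by move=> us /=; rewrite H1 b1E.
apply/homotopy_classP; exists (mkcts cL).
have L0 t : L (t, zero) = val b0' t.
  rewrite LE; last by right; left; exact: zero_le0.
  by rewrite /e /step interval_val0 invr_ge0 ler0n.
have L1 t : L (t, one) = val b1' t.
  rewrite LE; last by right; right; exact: one_ge1.
  by rewrite /e /step interval_val1 ifF //; apply/negbTE; lra.
have LB t s : cube_boundary t -> L (t, s) = val b0' t.
  move=> tB; rewrite LE; last by left.
  by rewrite e_collar ?based_cube_map_boundary //; exact: collar_boundary.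
by split; [exact: L0 | exact: L1 | exact: LB].
Qed.

Lemma shrinking_weak_equivalence : weak_equivalence R p.
Proof.
split; first exact: shrinking_pi0.
by move=> n y; apply: inj_surj_bijective; [exact: shrinking_pin_inj | exact: shrinking_pin_surj].
Qed.

End ShrinkingWeakEquivalence.

(** * The Cech projection is locally shrinkable *)

Lemma interval_locally_compact {R : realType} (k : unit_interval R) V :
  nbhs k V -> exists C, [/\ nbhs k C, compact C & C `<=` V].
Proof.
move=> /nbhs_set_type[W /nbhs_ballP[e /= e0 eW] WV].
have cd := @dist_cts R R^o _ _ (val k) (@interval_val_continuous R).
exists [set s | `|val s - val k| <= e / 2]; split.
- have kk : `|val k - val k| < e / 2 by rewrite subrr normr0 divr_gt0.
  by apply: filterS (near_lt (@cd k) kk) => s /ltW.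
- apply: subclosed_compact (@interval_compact R) _ => //.
  by apply: (preimage_closed _ (@closed_le R (e / 2))) => s _; exact: cd.
- move=> s /= se; apply/WV/eW; rewrite -ball_normE /= distrC.
  by apply: le_lt_trans se _; lra.
Qed.

(** * Cones on simplicial operators and on simplices *)

Section ConeMap.
Context {m n : nat}.

(** The ordinal sum of the one-point ordinal with [theta]: the new least element is the cone vertex,
    and [theta] acts on the rest. *)
Definition cone_map (theta : 'I_m.+1 -> 'I_n.+1) (i : 'I_m.+2) : 'I_n.+2 :=
  if unlift ord0 i is Some j then lift ord0 (theta j) else ord0.

Lemma cone_map_homo (theta : {omorphism 'I_m.+1 -> 'I_n.+1}) :
  {homo cone_map theta : x y / (x <= y)%O}.
Proof.
move=> x y; rewrite /cone_map.
case: unliftP => [i ->|-> _]; last by rewrite leEord leq0n.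
case: unliftP => [j ->|->]; rewrite !leEord /= /bump /= ?add1n ?ltn0 // !ltnS.
exact: (omorph_le theta).
Qed.

HB.instance Definition _ (theta : {omorphism 'I_m.+1 -> 'I_n.+1}) :=
  Order.isOrderMorphism.Build _ _ _ _ (cone_map theta) (cone_map_homo theta).

End ConeMap.

Lemma lift0_homo n : {homo lift (@ord0 n.+1) : x y / (x <= y)%O}.
Proof. by move=> x y; rewrite !leEord /= /bump /= !add1n ltnS. Qed.

HB.instance Definition _ n :=
  Order.isOrderMorphism.Build _ _ _ _ (lift (@ord0 n.+1)) (@lift0_homo n).

Definition vertex0 n (i : 'I_1) : 'I_n.+1 := ord0.

Lemma vertex0_homo n : {homo @vertex0 n : x y / (x <= y)%O}.
Proof. by []. Qed.

HB.instance Definition _ n :=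
  Order.isOrderMorphism.Build _ _ _ _ (@vertex0 n) (@vertex0_homo n).

Section ConeSimplex.
Context {R : realType}.
Local Notation I := (unit_interval R).

Section ConePoint.
Context {n : nat}.

Lemma cone_point_subproof (ts : simplex R n * I) :
  \row_i (if unlift ord0 i is Some j then (1 - val ts.2) * val ts.1 0 j else val ts.2)
    \in @simplex_set R n.+1.
Proof.
have [t0 t1] := set_mem (valP ts.1); have /andP[s0 s1] := interval_val ts.2.
apply/mem_set; split=> [i|].
  by rewrite mxE; case: unliftP => [j _|_] //; rewrite mulr_ge0 ?subr_ge0.
rewrite big_ord_recl mxE unlift_none.
under eq_bigr do rewrite mxE liftK.
by rewrite -mulr_sumr t1; ring.
Qed.

(** In barycentric coordinates, the point at time [s] on the segment from [t], placed on the face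
    opposite vertex 0, to that vertex. *)
Definition cone_point (ts : simplex R n * I) : simplex R n.+1 :=
  exist _ (\row_i (if unlift ord0 i is Some j then (1 - val ts.2) * val ts.1 0 j
                   else val ts.2)) (cone_point_subproof ts).

Lemma cone_point0 ts : val (cone_point ts) 0 ord0 = val ts.2.
Proof. by rewrite mxE unlift_none. Qed.

Lemma cone_pointS ts j :
  val (cone_point ts) 0 (lift ord0 j) = (1 - val ts.2) * val ts.1 0 j.
Proof. by rewrite mxE liftK. Qed.

Lemma simplexP (t u : simplex R n) : (forall i, val t 0 i = val u 0 i) -> t = u.
Proof. by move=> tu; apply/val_inj/rowP. Qed.

Lemma simplex_pushE m (theta : 'I_m.+1 -> 'I_n.+1) (t : simplex R m) j :
  val (simplex_push theta t) 0 j = \sum_(i | theta i == j) val t 0 i.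
Proof. by rewrite mxE. Qed.

Lemma cone_point_continuous : continuous cone_point.
Proof.
apply: into_set_type_cts => ts; apply: rV_cts_at => i.
have cs : continuous (fun ts : simplex R n * I => val ts.2).
  exact: comp_cts snd_cts interval_val_continuous.
have ct j : continuous (fun ts : simplex R n * I => val ts.1 0 j).
  have cv : continuous (fun ts : simplex R n * I => val ts.1).
    by apply: comp_cts fst_cts _; exact: val_cts.
  exact: comp_cts cv (@coord_continuous R 1 n.+1 0 j).
case: (unliftP ord0 i) => [j|] ->.
- have -> : (fun ts => (val \o cone_point) ts 0 (lift ord0 j)) =
      (fun ts : simplex R n * I => (1 - val ts.2) * val ts.1 0 j).
    by apply/funext => us; rewrite /= mxE liftK.
  by apply: cvgM; [apply: cvgB; [exact: cvg_cst | exact: cs] | exact: ct].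
- have -> : (fun ts => (val \o cone_point) ts 0 ord0) =
      (fun ts : simplex R n * I => val ts.2).
    by apply/funext => us; rewrite /= mxE unlift_none.
  exact: cs.
Qed.

End ConePoint.

(** Naturality of the cone, which makes the deformation compatible with the gluing relation. *)
Lemma cone_point_push m n (theta : 'I_m.+1 -> 'I_n.+1) (t : simplex R m) (s : I) :
  simplex_push (cone_map theta) (cone_point (t, s)) =
  cone_point (simplex_push theta t, s).
Proof.
apply: simplexP => j; rewrite simplex_pushE big_mkcond big_ord_recl.
rewrite /cone_map unlift_none cone_point0.
under eq_bigr do rewrite liftK cone_pointS.
case: (unliftP ord0 j) => [k|] ->.
- rewrite cone_pointS simplex_pushE mulr_sumr /= add0r [RHS]big_mkcond /=.
  by apply: eq_bigr => i _; rewrite (inj_eq (@lift_inj _ ord0)).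
- by rewrite cone_point0 eqxx big1 //= addr0.
Qed.

(** At time zero the cone point lies on the face opposite the cone vertex, so gluing can remove that
    vertex. *)
Lemma cone_point_zero n (t : simplex R n) :
  simplex_push (lift ord0) t = cone_point (t, zero).
Proof.
apply: simplexP => j; rewrite simplex_pushE.
case: (unliftP ord0 j) => [k|] ->.
- by rewrite cone_pointS interval_val0 subr0 mul1r (big_pred1 k).
- by rewrite cone_point0 interval_val0 big_pred0.
Qed.

Lemma simplex_point_subproof : const_mx 1 \in @simplex_set R 0.
Proof.
by apply/mem_set; split=> [i|]; rewrite ?big_ord1 mxE.
Qed.

Definition simplex_point : simplex R 0 := exist _ (const_mx 1) simplex_point_subproof.

(** At time one every [t] is sent to the cone vertex, so gluing leaves a 0-simplex. *)
Lemma cone_point_one n (t : simplex R n) :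
  simplex_push (@vertex0 n.+1) simplex_point = cone_point (t, one).
Proof.
apply: simplexP => j; rewrite simplex_pushE.
case: (unliftP ord0 j) => [k|] ->.
- by rewrite cone_pointS interval_val1 subrr mul0r big_pred0.
- by rewrite cone_point0 interval_val1 big_mkcond big_ord1 /= mxE.
Qed.

End ConeSimplex.


(** * Joining with a vertex in the Čech complex *)

Section CechShrinking.
Context {R : realType} {X : topologicalType} {A : choiceType} (U : A -> set X).
Local Notation I := (unit_interval R).
Local Notation C := (cech_complex U).

Lemma cech_simplicesP n (w z : cech_simplices U n) :
  (forall i, projT1 w i = projT1 z i) -> val (projT2 w) = val (projT2 z) -> w = z.
Proof.
case: w z => [b x] [c y] /= /funext bc.
by case: c / bc y => y xy; congr (existT _ _ _); exact: val_inj.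
Qed.

Lemma realization_class_glue m n (theta : {omorphism 'I_m.+1 -> 'I_n.+1})
    (w : C n) (t : simplex R m) :
  realization_class (existT _ m (sact theta w, t) : pre_realization R C) =
  realization_class (existT _ n (w, simplex_push theta t)).
Proof. by apply/eqmodP/asboolP; apply: rst_step; constructor. Qed.

Section Cone.
Context (a : A).

Definition cone_index n (b : 'I_n.+1 -> A) (i : 'I_n.+2) : A :=
  if unlift ord0 i is Some j then b j else a.

Lemma cone_interP n (b : 'I_n.+1 -> A) x :
  cech_inter U (cone_index b) x <-> U a x /\ cech_inter U b x.
Proof.
split=> [Ux|[Ua Ub] i _].
  split=> [|i _]; first by have := Ux ord0 Logic.I; rewrite /cone_index unlift_none.
  by have := Ux (lift ord0 i) Logic.I; rewrite /cone_index liftK.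
by rewrite /cone_index; case: unliftP => [j _|_] //; exact: Ub.
Qed.

Lemma cone_simplex_subproof n (w : C n) :
  U a (val (projT2 w)) -> val (projT2 w) \in cech_inter U (cone_index (projT1 w)).
Proof.
by move=> Ua; apply/mem_set/cone_interP; split=> //; exact: (set_mem (valP (projT2 w))).
Qed.

Definition cone_simplex n (w : C n) (Ua : U a (val (projT2 w))) : C n.+1 :=
  existT (fun b => set_type (cech_inter U b)) (cone_index (projT1 w))
    (exist _ (val (projT2 w)) (cone_simplex_subproof Ua)).

(** Simplicial operators keep the underlying point of [X], so the same proof [Ua] serves on both
    sides. *)
Lemma cone_simplex_act m n (theta : {omorphism 'I_m.+1 -> 'I_n.+1}) (w : C n)
    (Ua : U a (val (projT2 w))) :
  sact (cone_map theta) (cone_simplex Ua) = cone_simplex (w := sact theta w) Ua.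
Proof.
apply: cech_simplicesP => //= i; rewrite /cone_map /cone_index.
by case: (unliftP ord0 i) => [j _|_]; rewrite ?liftK ?unlift_none.
Qed.

(** Joins a representative with the vertex [a]. Being the identity away from [U a], it respects
    gluing and starts at the identity everywhere. *)
Definition cone (q : pre_realization R C) (s : I) : pre_realization R C :=
  if pselect (U a (cech_pre_projection q)) is left Ua then
    existT (fun n => (C n * simplex R n)%type) (projT1 q).+1
      (cone_simplex (w := (projT2 q).1) Ua, cone_point ((projT2 q).2, s))
  else q.

Lemma coneE n (w : C n) t s (Ua : U a (val (projT2 w))) :
  cone (existT _ n (w, t)) s = existT _ n.+1 (cone_simplex Ua, cone_point (t, s)).
Proof.
by rewrite /cone; case: pselect => // Ua'; rewrite (Prop_irrelevance Ua' Ua).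
Qed.

Lemma cone_out q s : ~ U a (cech_pre_projection q) -> cone q s = q.
Proof. by rewrite /cone; case: pselect. Qed.

Lemma cone_class (q q' : pre_realization R C) s :
  realization_eq q q' -> realization_class (cone q s) = realization_class (cone q' s).
Proof.
move=> /asboolP; elim=> {q q'} [_ _ [m n theta w t]|//|q q' _ -> //|]; last first.
  by move=> q q' r _ -> _ ->.
have [Ua|nUa] := pselect (U a (val (projT2 w))).
  by rewrite (coneE t s (w := sact theta w) Ua) coneE -cone_simplex_act
    realization_class_glue cone_point_push.
by rewrite !cone_out // realization_class_glue.
Qed.

Lemma cone0 q : realization_class (cone q zero) = realization_class q.
Proof.
case: q => n [w t]; have [Ua|nUa] := pselect (U a (val (projT2 w))); last first.
  by rewrite cone_out.
rewrite coneE -cone_point_zero -realization_class_glue.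
congr (realization_class (existT _ n (_, t))).
by apply: cech_simplicesP => //= i; rewrite /cone_index liftK.
Qed.

Definition vertex_simplex (x : set_type (cech_inter U (fun _ : 'I_1 => a))) :
    pre_realization R C :=
  existT (fun n => (C n * simplex R n)%type) 0
    (existT (fun b => set_type (cech_inter U b)) (fun=> a) x, simplex_point).

Lemma cone1 q x : val x = cech_pre_projection q ->
  realization_class (cone q one) = realization_class (vertex_simplex x).
Proof.
case: q => n [w t] xE.
have Ua : U a (val (projT2 w)).
  by rewrite -[val _]xE; exact: (set_mem (valP x) ord0 Logic.I).
rewrite coneE -(cone_point_one t) -realization_class_glue.
congr (realization_class (existT _ 0 (_, _))).
by apply: cech_simplicesP => //= i; rewrite /cone_index unlift_none.
Qed.

Lemma cone_projection q s : cech_pre_projection (cone q s) = cech_pre_projection q.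
Proof. by rewrite /cone; case: pselect. Qed.

Lemma vertex_simplex_continuous : continuous vertex_simplex.
Proof.
apply: comp_cts (@existT_continuous _ (fun n => (C n * simplex R n)%type) 0).
apply: pair_cts; last exact: cst_continuous.
exact: (@existT_continuous _ (fun b : 'I_1 -> A => set_type (cech_inter U b))).
Qed.

Section Continuity.
Hypothesis U_open : forall a, open (U a).
Context {n : nat} (b : 'I_n.+1 -> A).

Lemma cone_restrict_subproof (x : set_type (cech_inter U (cone_index b))) :
  val x \in cech_inter U b.
Proof. by have /cone_interP[_ /mem_set] := set_mem (valP x). Qed.

Definition cone_restrict (x : set_type (cech_inter U (cone_index b))) :
    set_type (cech_inter U b) :=
  exist _ (val x) (cone_restrict_subproof x).

(** The map is the inclusion of the part lying in the open set [U a]. *)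
Lemma cone_restrict_open_map : open_map cone_restrict.
Proof.
move=> x B /nbhs_set_type[V nV VB].
have Ux : U a (val x) by have /cone_interP[] := set_mem (valP x).
have nUV : nbhs (val x) (U a `&` V).
  by apply: filterI nV; exact: open_nbhs_nbhs.
have : nbhs (cone_restrict x) (val @^-1` (U a `&` V)).
  exact: (@val_cts _ (cech_inter U b) (cone_restrict x) _ nUV).
apply: filterS => z [Uz Vz].
have Uz' : val z \in cech_inter U (cone_index b).
  by apply/mem_set/cone_interP; split=> //; exact: (set_mem (valP z)).
by exists (exist _ (val z) Uz'); [exact: VB | exact: val_inj].
Qed.

(** An open chart onto the part of one summand that lies over [U a]. On it the case distinction in
    [cone] always takes the first branch. *)
Definition cone_chart (xt : set_type (cech_inter U (cone_index b)) * simplex R n) :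
    pre_realization R C :=
  existT (fun n => (C n * simplex R n)%type) n
    (existT (fun b => set_type (cech_inter U b)) b (cone_restrict xt.1), xt.2).

Lemma cone_chart_open_map : open_map cone_chart.
Proof.
have o1 := open_map_comp cone_restrict_open_map
  (@open_map_existT _ (fun b : 'I_n.+1 -> A => set_type (cech_inter U b)) b).
exact: open_map_comp (open_map_pair (Z := simplex R n) o1)
  (@open_map_existT _ (fun n => (C n * simplex R n)%type) n).
Qed.

Lemma cone_chart_continuous :
  continuous (fun xts : (_ * simplex R n) * I => cone (cone_chart xts.1) xts.2).
Proof.
pose f (xts : (set_type (cech_inter U (cone_index b)) * simplex R n) * I) :
    pre_realization R C :=
  existT (fun n => (C n * simplex R n)%type) n.+1
    (existT (fun b => set_type (cech_inter U b)) (cone_index b) xts.1.1,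
     cone_point (xts.1.2, xts.2)).
rewrite (_ : (fun xts => _) = f); last first.
  apply/funext => -[[x t] s].
  have Ux : U a (val x) by have /cone_interP[] := set_mem (valP x).
  pose w : C n := existT (fun b => set_type (cech_inter U b)) b (cone_restrict x).
  apply: (etrans (coneE (w := w) t s Ux)).
  have -> : cone_simplex (w := w) Ux =
      existT (fun b => set_type (cech_inter U b)) (cone_index b) x.
    exact: cech_simplicesP.
  by [].
apply: comp_cts (@existT_continuous _ (fun n => (C n * simplex R n)%type) n.+1).
apply: pair_cts.
  apply: (comp_cts (comp_cts fst_cts fst_cts)).
  exact: (@existT_continuous _ (fun b : 'I_n.+2 -> A => set_type (cech_inter U b))).
apply: comp_cts cone_point_continuous; apply: pair_cts; last exact: snd_cts.
exact: (comp_cts fst_cts snd_cts).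
Qed.

End Continuity.
End Cone.

Lemma cech_projection_shrinking : (forall a, open (U a)) ->
  \bigcup_(a in [set: A]) U a = [set: X] ->
  exists v J, shrinking (R := R) (@cech_projection X A U R) U v J.
Proof.
move=> U_open U_cover.
have cech_mem a x : U a x -> x \in cech_inter U (fun _ : 'I_1 => a).
  by move=> Ua; apply/mem_set => i _.
(* The section must be total, but the realization is empty when [X] is. Away from [U a] it therefore
   takes the vertex of some cover member containing [x]. *)
have idx x : exists b, U b x.
  by have [b _ Ub] : (\bigcup_(a in [set: A]) U a) x by [rewrite U_cover]; exists b.
have [b bP] := choice idx.
pose c a x := if pselect (U a x) is left _ then a else b x.
have cP a x : U (c a x) x by rewrite /c; case: pselect.
pose vert a x (Ux : U a x) : realization R C :=
  realization_class (vertex_simplex (exist _ x (cech_mem a x Ux))).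
pose v a x := vert (c a x) x (cP a x).
have vE a x (Ux : U a x) : v a x = vert a x Ux.
  have cE : c a x = a by rewrite /c; case: pselect.
  rewrite /v; move: (cP a x); rewrite cE => Ux'.
  by rewrite (Prop_irrelevance Ux' Ux).
(* Defined through a chosen representative; [JE] shows by [cone_class] that any representative may
   be used. *)
pose J a (ys : realization R C * I) : realization R C :=
  realization_class (cone a (repr (ys.1 : {eq_quot realization_equiv R C})) ys.2).
have JE a q s : J a (realization_class q, s) = realization_class (cone a q s).
  apply: cone_class.
  suff /eqmodP : repr (\pi_{eq_quot realization_equiv R C} q) =
    q %[mod {eq_quot realization_equiv R C}] by [].
  by rewrite reprK.
have classK (y : realization R C) : exists q, y = realization_class q.
  exists (repr (y : {eq_quot realization_equiv R C})).
  by rewrite /realization_class reprK.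
exists v, J; split.
- move=> a x Ux.
  have Ux' := cech_mem a x Ux.
  have oU : open (cech_inter U (fun _ : 'I_1 => a)).
    rewrite (_ : cech_inter _ _ = U a) //.
    by apply/seteqP; split=> [z /(_ ord0 Logic.I)|z Uz i _].
  pose z0 : set_type (cech_inter U (fun _ : 'I_1 => a)) := exist _ x Ux'.
  suff : {for val z0, continuous (v a)} by [].
  apply: cts_at_open_map; first exact: open_map_val.
  have E (z : set_type (cech_inter U (fun _ : 'I_1 => a))) :
      v a (val z) = realization_class (vertex_simplex z).
    have Uz := set_mem (valP z) ord0 Logic.I.
    rewrite (vE _ _ Uz); congr (realization_class (vertex_simplex _)); exact: val_inj.
  rewrite (_ : _ \o _ = (fun z => realization_class (vertex_simplex z))); last first.
    by apply/funext => z; exact: E.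
  exact: (comp_cts (@vertex_simplex_continuous a) (@pi_continuous _ _)).
- by move=> a x Ux; rewrite (vE _ _ Ux) cech_projectionE.
- move=> a y s Uy.
  (* Reduces continuity on the quotient times the interval to continuity on representatives lying
     over [U a], where the charts apply. *)
  apply: (@cts_at_quotient_prod _ _ _ _ (@cech_projection X A U R @^-1` U a)
    (J a)) Uy; first exact: interval_locally_compact.
    by apply: open_comp => // z _; exact: cech_projection_continuous.
  move=> [n [[d x] t]] k Ux.
  have {}Ux : U a (val x).
    by move: Ux; rewrite /preimage /= cech_projectionE.
  have Ux' : val x \in cech_inter U (cone_index a d).
    by apply/mem_set/cone_interP; split=> //; exact: (set_mem (valP x)).
  pose z0 : set_type (cech_inter U (cone_index a d)) := exist _ (val x) Ux'.
  have -> : (existT _ n (existT _ d x, t) : pre_realization R C) =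
      cone_chart (z0, t).
    have -> : x = cone_restrict z0 by exact: val_inj.
    by [].
  apply: (@cts_at_open_map _ _ _ (fun xtk : _ * I => (cone_chart xtk.1, xtk.2))
    _ (z0, t, k)).
    by apply: open_map_pair; exact: cone_chart_open_map.
  rewrite (_ : _ \o _ = (fun xtk : _ * I =>
      realization_class (cone a (cone_chart xtk.1) xtk.2))); last first.
    by apply/funext => xtk; exact: JE.
  exact: (comp_cts (@cone_chart_continuous a n d) (@pi_continuous _ _)).
- move=> a y s Uy; have [q yq] := classK y; subst y.
  by rewrite JE !cech_projectionE cone_projection.
- by move=> a y; have [q ->] := classK y; rewrite JE cone0.
- move=> a y; have [q ->] := classK y; rewrite cech_projectionE => Uq.
  by rewrite JE (vE _ _ Uq); exact: cone1.
Qed.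

End CechShrinking.

Theorem theorem2p1 (R : realType) (X : topologicalType) (A : choiceType)
    (U : A -> set X) (U_open : forall a : A, open (U a))
    (U_cover : \bigcup_(a in [set: A]) U a = [set: X]) :
  weak_equivalence R (@cech_projection X A U R).
Proof.
have [v [J vJ]] := cech_projection_shrinking (R := R) U_open U_cover.
exact: (shrinking_weak_equivalence (p := @cech_projection X A U R) vJ U_open U_cover).
Qed.
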